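(* If $T$ is a Suslin tree, then its road space $\mathrm{Road}(T)$ is a ccc branchwise-real tree order with no continuous grading.
   Context: A tree order is a partial order with a minimum element such that for every $x$ the set $\{y\mid y\le x\}$ is linearly ordered; a branch is a maximal linearly ordered subset. A well-stratified tree is a tree order in which each $\{y\mid y\le x\}$ is well-ordered; the rank of $x$ is the order type of $\{y\mid y<x\}$, $T(\alpha)$ is the set of rank-$\alpha$ elements, and the height is the least $\alpha$ with $T(\alpha)=\emptyset$. An antichain is a set of pairwise incomparable elements; a tree order is ccc if it has no uncountable antichain. An Aronszajn tree is a well-stratified tree of height $\omega_1$ all of whose levels and branches are countable; a Suslin tree is a ccc Aronszajn tree. $\mathrm{Road}(T)$ is the suborder of the lexicographic product $T\times(0,1]$ consisting of the pairs $\langle x,t\rangle$ with $t=1$ or $x\in T(\alpha+1)$ for some ordinal $\alpha$. A branchwise-real tree order is a tree order in which every branch is order-isomorphic to a real interval and any two elements have a greatest lower bound. A continuous grading is a strictly monotonic $\ell\colon X\to\mathbb{R}$ whose restriction to each $[x,y]=\{z\mid x\le z\le y\}$ ($x<y$) is an order-isomorphism onto $[\ell(x),\ell(y)]$.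
   Formalization: The tree T is additionally assumed Hausdorff: nodes of limit rank with the same strict predecessors are equal. Otherwise two such nodes x, y give points ⟨x,1⟩, ⟨y,1⟩ of Road(T) with no greatest lower bound, so Road(T) is not branchwise-real. *)

(* Defs.v *)
From HB Require Import structures.
From mathcomp Require Import all_boot all_order all_algebra.
From mathcomp Require Import all_classical all_reals.
From mathcomp Require wochoice.

Set Implicit Arguments.
Unset Strict Implicit.
Unset Printing Implicit Defensive.

Import Order.TTheory GRing.Theory Num.Theory.
Local Open Scope classical_set_scope.
Local Open Scope order_scope.

(* The isomorphism is between the subtypes of elements of A and of B (rather   *)
(* than induced by a total function T -> U), so that two empty sets are        *)
(* isomorphic even when U is empty.                                            *)
Definition order_isomorphic {d d'} {T : porderType d} {U : porderType d'}
    (A : set T) (B : set U) : Prop :=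
  exists2 f : A -> B,
    bijective f & forall x y : A, (val (f x) <= val (f y)) = (val x <= val y).

Definition linearly_ordered {d} {T : porderType d} (A : set T) : Prop :=
  total_on A (fun x y => x <= y).

Definition well_ordered {d} {T : porderType d} (A : set T) : Prop :=
  wochoice.wo_chain (fun x y : T => x <= y) (fun x => x \in A).

(* Ordinals are represented by well-ordered subsets A of arbitrary partially   *)
(* ordered types, taken up to order_isomorphic; the ordinals below (the one    *)
(* represented by) A are then the A `&` [set b | b < a] for a in A.            *)

Definition ordinal_succ {d d'} {W : porderType d} {V : porderType d'}
    (A : set W) (B : set V) : Prop :=
  exists2 m, B m /\ (forall b, B b -> b <= m) &
             order_isomorphic A (B `\ m).

Definition is_omega1 {d} {W : porderType d} (A : set W) : Prop :=
  [/\ well_ordered A,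
      ~ countable A &
      forall a, A a -> countable (A `&` [set b | b < a])].

Definition tree_order {d} (X : porderType d) : Prop :=
  (exists r : X, forall x, r <= x) /\
  (forall x : X, linearly_ordered [set y | y <= x]).

Definition branch {d} {X : porderType d} (B : set X) : Prop :=
  linearly_ordered B /\
  (forall C, linearly_ordered C -> B `<=` C -> C = B).

Definition antichain {d} {X : porderType d} (A : set X) : Prop :=
  forall x y, A x -> A y -> x <> y -> x >< y.

Definition ccc {d} (X : porderType d) : Prop :=
  forall A : set X, antichain A -> countable A.

Definition well_stratified {d} (T : porderType d) : Prop :=
  tree_order T /\ (forall x : T, well_ordered [set y | y <= x]).

Definition level {d d'} (T : porderType d) {W : porderType d'} (A : set W) :
    set T :=
  [set x | order_isomorphic [set y | y < x] A].
Arguments level {d d'} T {W} A.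

Definition has_height {d d'} (T : porderType d) {W : porderType d'}
    (A : set W) : Prop :=
  level T A = set0 /\
  (forall a, A a -> level T (A `&` [set b | b < a]) !=set0).

Definition successor_rank {d} {T : porderType d} (x : T) : Prop :=
  exists d1 (W : porderType d1) (A : set W) d2 (V : porderType d2) (B : set V),
    [/\ well_ordered A, well_ordered B, ordinal_succ A B & level T B x].

Definition aronszajn {d} (T : porderType d) : Prop :=
  [/\ well_stratified T,
      exists d1 (W : porderType d1) (A : set W), is_omega1 A /\ has_height T A,
      forall d1 (W : porderType d1) (A : set W),
        well_ordered A -> countable (level T A) &
      forall B : set T, branch B -> countable B].

Definition suslin {d} (T : porderType d) : Prop := ccc T /\ aronszajn T.

(* The usual normality convention for set-theoretic trees: a node of limit     *)
(* rank is determined by its set of strict predecessors.  (At rank 0 the       *)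
(* condition says that the root is unique, which always holds.)  Two distinct  *)
(* nodes x, y of limit rank with the same predecessors would give points       *)
(* (x, 1), (y, 1) of the road space without a greatest lower bound.            *)
Definition hausdorff_tree {d} (T : porderType d) : Prop :=
  forall x y : T, ~ successor_rank x -> ~ successor_rank y ->
    [set z | z < x] = [set z | z < y] -> x = y.

Definition road_set (R : realType) {d} (T : porderType d) :
    set (T *lexi[d] R) :=
  [set p | 0%R < p.2 <= 1%R /\ (p.2 = 1%R \/ successor_rank p.1)].
Arguments road_set R {d} T.

Definition road (R : realType) {d} (T : porderType d) : Type :=
  set_type (road_set R T).

HB.instance Definition _ (R : realType) {d} (T : porderType d) :=
  SubChoice.on (road R T).
HB.instance Definition _ (R : realType) {d} (T : porderType d) :=
  [SubChoice_isSubPOrder of road R T by <: with d].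

Definition branchwise_real (R : realType) {d} (X : porderType d) : Prop :=
  [/\ tree_order X,
      forall B : set X, branch B ->
        exists i : interval R, order_isomorphic B [set` i] &
      forall x y : X, exists m : X,
        [/\ m <= x, m <= y & forall z, z <= x -> z <= y -> z <= m]].

Definition continuous_grading (R : realType) {d} {X : porderType d}
    (l : X -> R) : Prop :=
  {homo l : x y / x < y} /\
  (forall x y : X, x < y ->
    set_bij [set` `[x, y]] [set` `[l x, l y]] l /\
    {in `[x, y] &, {mono l : u v / u <= v}}).

(* Main.v *)
(* A strictly increasing map l on the road space restricts, through x |->
   (x, 1), to a strictly increasing real function on T. Rationals chosen
   between its values at a node of successor rank and at the immediate
   predecessor split the uncountably many such nodes into countably many
   antichains, which contradicts the ccc.

   A branch of the road space consists of the points lying over a branch C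
   of T. As C is countable, its nodes e_0, e_1, ... can be given the weights
   2^-(i+1); the total weight of the nodes of successor rank passed on the
   way to (x, t), with the node x itself, if of successor rank, counted for
   the fraction t, is an order isomorphism from the branch onto a real
   interval.

   The common predecessors of two incomparable nodes of T have a greatest
   element m, for otherwise the Hausdorff condition would identify the nodes
   at which they split; then (m, 1) is the meet of any two points lying over
   them. *)

Require Import Defs.
From mathcomp Require Import all_boot all_order all_algebra.
From mathcomp Require Import all_classical all_reals.
From mathcomp Require num_normedtype normed_module.

Set Implicit Arguments.
Unset Strict Implicit.
Unset Printing Implicit Defensive.

Import Order.TTheory GRing.Theory Num.Theory.
Local Open Scope classical_set_scope.
Local Open Scope ring_scope.
Local Open Scope order_scope.

(** * Countability, well-orders and order isomorphisms *)

Lemma countable_inj_in {T U : Type} (f : T -> U) (A : set T) (B : set U) :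
  (forall x, A x -> B (f x)) ->
  (forall x y, A x -> A y -> f x = f y -> x = y) ->
  countable B -> countable A.
Proof.
move=> fAB finj /countable_injP[g ginj]; apply/countable_injP.
exists (g \o f) => x y; rewrite !inE => Ax Ay /= gfxy.
by apply: finj => //; apply: ginj; rewrite ?inE//; exact: fAB.
Qed.

Section WellOrdered.
Context {d : Order.disp_t} {T : porderType d}.
Implicit Types (x y z p : T) (A B C D : set T).

Lemma well_ordered_min A D : well_ordered A -> D `<=` A -> D !=set0 ->
  exists2 m, D m & forall z, D z -> m <= z.
Proof.
move=> woA DA [x Dx].
have [||m [[mD mlb] _]] := woA (fun x => x \in D).
- by move=> y /set_mem/DA/mem_set.
- by exists x; exact/mem_set.
- exists m; first exact: set_mem.
  by move=> z /mem_set; exact: mlb.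
Qed.

Lemma well_ordered_sub A B : A `<=` B -> well_ordered B -> well_ordered A.
Proof.
move=> AB woB C CA; apply: woB => x /CA /set_mem/AB; exact: mem_set.
Qed.

Lemma well_ordered_linear A : well_ordered A -> linearly_ordered A.
Proof.
move=> woA x y Ax Ay.
have [||m mxy mle] := well_ordered_min (D := [set x; y]) woA.
- by move=> _ [] ->.
- by exists x; left.
by case: mxy mle => -> mle; [left|right]; apply: mle; [right|left].
Qed.
End WellOrdered.

Lemma order_isomorphic_refl {d} {T : porderType d} (A : set T) :
  order_isomorphic A A.
Proof. by exists id => //; exists id. Qed.

Lemma order_isomorphic_sym {d d'} {T : porderType d} {U : porderType d'}
    (A : set T) (B : set U) : order_isomorphic A B -> order_isomorphic B A.
Proof.
move=> [f [g fK gK] fle]; exists g; first by exists f.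
by move=> x y; rewrite -fle !gK.
Qed.

Lemma order_isomorphic_trans {d d' d''} {T : porderType d} {U : porderType d'}
    {V : porderType d''} (A : set T) (B : set U) (C : set V) :
  order_isomorphic A B -> order_isomorphic B C -> order_isomorphic A C.
Proof.
move=> [f fbij fle] [g gbij gle]; exists (g \o f); first exact: bij_comp.
by move=> x y /=; rewrite gle fle.
Qed.

Lemma order_isomorphic_image {d d'} {T : porderType d} {U : porderType d'}
    (A : set T) (f : T -> U) :
  {in A &, forall x y, (f x <= f y) = (x <= y)} ->
  order_isomorphic A (f @` A).
Proof.
move=> fle.
have fA (x : A) : f (val x) \in f @` A.
  by apply/mem_set; exists (val x) => //; exact: set_valP.
pose g (x : A) : f @` A := SigSub (fA x).
have gle (x y : A) : (val (g x) <= val (g y)) = (val x <= val y).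
  by rewrite /= fle//; apply: mem_set; exact: set_valP.
exists g => //; rewrite -setTT_bijective; split => //.
- move=> x y _ _ gxy; apply/val_inj/le_anti.
  by rewrite -!gle gxy lexx.
- move=> [y yfA] _; have [x Ax fxy] := set_mem yfA.
  by exists (SigSub (mem_set Ax)) => //; apply: val_inj.
Qed.

(* An order isomorphism onto a proper initial segment would be regressive at *)
(* a least point z, and then regressive at the image of z.                   *)
Lemma initial_segment_inj {d d'} {T : porderType d} {W : porderType d'}
    (A : set W) (P : set T) a b :
  well_ordered A -> A a -> A b ->
  order_isomorphic P (A `&` [set c | c < a]) ->
  order_isomorphic P (A `&` [set c | c < b]) -> a = b.
Proof.
move=> woA Aa Ab.
wlog ab : a b Aa Ab / a <= b.
  move=> H Pa Pb; have [ab|ba] := well_ordered_linear woA Aa Ab.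
    exact: H.
  by apply/esym; exact: H.
move=> Pa Pb; apply/eqP; apply/negP => /negP neq_ab.
have {neq_ab} ab : a < b by rewrite lt_neqAle neq_ab.
have [f [g fK gK] fle] :=
  order_isomorphic_trans (order_isomorphic_sym Pb) Pa.
have fA (z : (A `&` [set c | c < b] : set W)) : A (val (f z)) /\ val (f z) < a.
  exact: set_valP (f z).
pose D := [set val z | z in [set z | val (f z) < val z]].
have [||m [z fz <-] zle] := well_ordered_min (D := D) woA.
- by move=> _ [z _ <-]; case: (set_valP z).
(* [D] is nonempty: [a] lies below [b], and its image lies below [a]. *)
- have bA : a \in A `&` [set c | c < b] by apply/mem_set.
  by exists a; exists (SigSub bA) => //=; case: (fA (SigSub bA)).
have fzA : val (f z) \in A `&` [set c | c < b].
  by apply/mem_set; have [? ?] := fA z; split => //=; apply: lt_trans ab.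
suff /(lt_le_trans fz) : val z <= val (f z) by rewrite ltxx.
have flt x y : (val (f x) < val (f y)) = (val x < val y).
  by rewrite !lt_leAnge !fle.
by apply: zle; exists (SigSub fzA) => //=; rewrite flt.
Qed.

(** * Immediate predecessors and splitting nodes in well-stratified trees *)

Section WellStratified.
Context {d : Order.disp_t} {T : porderType d}.
Implicit Types (x y z p : T) (A B C D : set T).

Definition immediate_pred p x := p < x /\ forall z, z < x -> z <= p.

Hypothesis wsT : well_stratified T.

Lemma tree_linear x y z : y <= x -> z <= x -> y <= z \/ z <= y.
Proof. by case: wsT => -[_ lin] _; exact: lin. Qed.

Lemma chain_min C : linearly_ordered C -> C !=set0 ->
  exists2 m, C m & forall z, C z -> m <= z.
Proof.
move=> linC [x Cx]; case: wsT => _ /(_ x) woX.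
have [||m [Cm mx] mle] := well_ordered_min (D := C `&` [set y | y <= x]) woX.
- by move=> y [].
- by exists x; split => /=.
exists m => // z Cz; have [zx|xz] := linC _ _ Cz Cx; first exact: mle.
exact: le_trans xz.
Qed.

Lemma down_min x D : D `<=` [set y | y <= x] -> D !=set0 ->
  exists2 m, D m & forall z, D z -> m <= z.
Proof.
by move=> Dx; apply: chain_min => y z /Dx yx /Dx; exact: tree_linear.
Qed.

(** An order isomorphism onto an ordinal with a maximum pulls that maximum back to the immediate
    predecessor. Conversely, the sets of strict predecessors of [p] and of [x] themselves serve as
    the two ordinals. *)
Lemma successor_rankP x : successor_rank x <-> exists p, immediate_pred p x.
Proof.
split.
  move=> [d1 [W [A [d2 [V [B]]]]]] [_ _ [m [Bm mmax] _] [f [g fK gK] fle]].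
  pose p : set_type [set y | y < x] := g (SigSub (mem_set Bm)).
  exists (val p); split; first exact: set_valP p.
  move=> z zx; rewrite -[z]/(val (SigSub (mem_set zx : z \in [set y | y < x]))).
  by rewrite -fle gK /=; apply: mmax; exact: set_valP.
move=> [p [px pmax]]; case: (wsT) => _ /(_ x) wox.
have ltx : [set y | y < x] `<=` [set y | y <= x] by move=> y /ltW.
have ltp : [set y | y < p] `<=` [set y | y < x] by move=> y /lt_trans; exact.
exists d, T, [set y | y < p], d, T, [set y | y < x]; split.
- exact/(well_ordered_sub ltp)/(well_ordered_sub ltx).
- exact/(well_ordered_sub ltx).
- exists p => //; suff -> : [set y | y < x] `\ p = [set y | y < p].
    exact: order_isomorphic_refl.
  apply/seteqP; split => y /=.
    by move=> [/pmax yp /eqP neqyp]; rewrite lt_neqAle neqyp.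
  move=> yp; split; first exact: lt_trans px.
  by move=> yE; move: yp; rewrite yE ltxx.
- exact: order_isomorphic_refl.
Qed.

Lemma next_exists x y : x < y ->
  exists2 z, immediate_pred x z & z <= y.
Proof.
move=> xy.
have [||z [xz zy] zle] := @down_min y [set z | x < z /\ z <= y].
- by move=> z [].
- by exists y.
exists z => //; split => // u uz.
have [] // := tree_linear (le_trans (ltW uz) zy) (ltW xy).
rewrite le_eqVlt => /predU1P[->//|xu].
have /zle zu : x < u /\ u <= y by split => //; exact: le_trans (ltW uz) zy.
by move: (lt_le_trans uz zu); rewrite ltxx.
Qed.

(** Let [I] be the set of common predecessors. The least nodes [x'] below [x] and [y'] below [y]
    that lie outside [I] both have [I] as set of strict predecessors. If one of them has successor
    rank, its immediate predecessor is the greatest element of [I]. Otherwise the Hausdorff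
    condition gives [x' = y'], a common predecessor outside [I], which is absurd. *)
Lemma incomparable_common_pred x y : hausdorff_tree T -> x >< y ->
  exists2 m, m < x /\ m < y & forall z, z <= x -> z <= y -> z <= m.
Proof.
move=> hT; rewrite /Order.comparable negb_or => /andP[nxy nyx].
pose I := [set z | z <= x /\ z <= y].
have Idown u v : I u -> v <= u -> I v.
  by move=> [ux uy] vu; split; exact: le_trans vu _.
have min_out w : I `<=` [set z | z <= w] -> ~ I w ->
    exists w', [/\ w' <= w, ~ I w' & [set z | z < w'] = I].
  move=> Iw nIw.
  have [||w' [w'w nIw'] w'min] := @down_min w [set z | z <= w /\ ~ I z].
  - by move=> z [].
  - by exists w.
  exists w'; split => //; apply/seteqP; split => z.
    move=> /= zw'; apply: contrapT => nIz.
    have /w'min : z <= w /\ ~ I z by split => //; exact: le_trans (ltW zw') w'w.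
    by move=> /(lt_le_trans zw'); rewrite ltxx.
  move=> Iz /=; have [zw'|/(Idown _ _ Iz)//] := tree_linear (Iw _ Iz) w'w.
  by rewrite lt_neqAle zw' andbT; apply/eqP => zE; apply: nIw'; rewrite -zE.
have [x' [x'x nIx' Ix']] : exists x',
    [/\ x' <= x, ~ I x' & [set z | z < x'] = I].
  by apply: min_out => [z []//|[_ xy]]; rewrite xy in nxy.
have [y' [y'y nIy' Iy']] : exists y',
    [/\ y' <= y, ~ I y' & [set z | z < y'] = I].
  by apply: min_out => [z []//|[yx _]]; rewrite yx in nyx.
have [p Ip pmax] : exists2 p, I p & forall z, I z -> z <= p.
  have pred w : [set z | z < w] = I -> successor_rank w ->
      exists2 p, I p & forall z, I z -> z <= p.
    by move=> Iw /successor_rankP[p [pw pmax]]; exists p; rewrite -Iw.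
  have [/(pred _ Ix')//|nsx'] := pselect (successor_rank x').
  have [/(pred _ Iy')//|nsy'] := pselect (successor_rank y').
  have x'y' : x' = y' by apply: hT => //; rewrite Ix' Iy'.
  by case: nIx'; split => //; rewrite x'y'.
case: (Ip) => px py; exists p; last by move=> z zx zy; exact: pmax.
by split; rewrite lt_neqAle ?px ?py andbT; apply/eqP => pE;
  [move: nxy|move: nyx]; rewrite -pE ?px ?py.
Qed.

End WellStratified.

(** * Strictly increasing real functions on a Suslin tree *)

(* The ranks a + 1 for a in omega_1 are pairwise distinct and all inhabited. *)
Lemma successor_rank_uncountable {d} (T : porderType d) :
  aronszajn T -> ~ countable [set x : T | successor_rank x].
Proof.
move=> [wsT [d1 [W [A [[woA ncA ctA] [_ lvlA]]]]] _ _].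
have linA := well_ordered_linear woA.
have nextA (a : W) : exists x : T, A a ->
    [/\ successor_rank x & exists2 b, A b &
      order_isomorphic [set y | y < x] (A `&` [set c | c < b]) /\
      A `&` [set c | c < b] = A `&` [set c | c <= a]].
  have [Aa|nAa] := pselect (A a); last by case: wsT => -[[r _] _] _; exists r.
  (* [a] is not the maximum of [A]: otherwise [A] would consist of [a] and the countably many
     elements below it. *)
  have [b0 Ab0 ab0] : exists2 b, A b & a < b.
    apply: contrapT => nb; apply: ncA.
    apply: (@sub_countable _ _ _ ((A `&` [set b | b < a]) `|` [set a]));
      last first.
      rewrite -bigcup2E; apply: bigcup_countable => // -[|[|i]] _ //=.
    exact: ctA.
    apply: subset_card_le => b Ab.
    have [ab|] := linA _ _ Aa Ab.
      right; apply/eqP; apply: contrapT => /negP ba; apply: nb.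
      by exists b => //; rewrite lt_neqAle eq_sym ba.
    by rewrite le_eqVlt => /predU1P[->|ba]; [right|left].
  (* The least such [b] is the successor of [a] in [A], so every node of rank [b] has successor
     rank. *)
  have [||b [Ab ab] bmin] := well_ordered_min (D := A `&` [set b | a < b]) woA.
  - by move=> ? [].
  - by exists b0.
  have Ab_a : A `&` [set c | c < b] = A `&` [set c | c <= a].
    apply/seteqP; split => c [Ac] /= cb; split => //=;
      last exact: le_lt_trans ab.
    have [ac|//] := linA _ _ Aa Ac.
    move: ac; rewrite le_eqVlt => /predU1P[->//|ac].
    by move: (lt_le_trans cb (bmin _ (conj Ac ac))); rewrite ltxx.
  have [x xb] := lvlA _ Ab; exists x => _; split; last by exists b.
  exists d1, W, (A `&` [set c | c < a]), d1, W, (A `&` [set c | c < b]).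
  split => //.
  - by apply: well_ordered_sub woA => ? [].
  - by apply: well_ordered_sub woA => ? [].
  - exists a; first by rewrite Ab_a; split=> [|c []]; first by split => /=.
    rewrite Ab_a.
    suff -> : (A `&` [set c | c <= a]) `\ a = A `&` [set c | c < a].
      exact: order_isomorphic_refl.
    apply/seteqP; split => c.
      by move=> [[Ac ca] /eqP neq_ca]; split; rewrite //= lt_neqAle neq_ca.
    move=> [Ac ca]; split; first by split => //=; exact: ltW.
    by move=> /= cE; move: ca; rewrite /= cE ltxx.
have [x xP] := choice nextA; apply: contra_not ncA.
(* A node has only one rank, so [x a = x b] makes [a] and [b] the greatest elements of the same
   initial segment of [A]. *)
apply: (@countable_inj_in _ _ x) => [a /xP[]//|a b Aa Ab xab].
have [_ [a' Aa' [isoa a'E]]] := xP _ Aa.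
have [_ [b' Ab' [isob b'E]]] := xP _ Ab.
rewrite xab in isoa; have ab' := initial_segment_inj woA Aa' Ab' isoa isob.
rewrite ab' {}b'E in a'E.
apply: le_anti; apply/andP; split.
  by have [] : (A `&` [set c | c <= b]) a by rewrite a'E; split => /=.
by have [] : (A `&` [set c | c <= a]) b by rewrite -a'E; split => /=.
Qed.

Lemma suslin_not_real_embeddable (R : realType) {d} (T : porderType d) :
  suslin T -> ~ exists l : T -> R, {homo l : x y / x < y}.
Proof.
move=> [cccT aroT] [l lmono]; case: (aroT) => wsT _ _ _.
have qx (x : T) : exists q : rat, successor_rank x ->
    exists2 p, immediate_pred p x & (l p < ratr q < l x)%R.
  have [/(successor_rankP wsT)[p px]|nsx] := pselect (successor_rank x);
    last by exists 0%R.
  have [q] := rat_in_itvoo (lmono _ _ (proj1 px)).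
  by rewrite in_itv /= => qP; exists q => _; exists p.
have [q qP] := choice qx.
apply: (successor_rank_uncountable aroT).
rewrite (_ : mkset _ =
    \bigcup_(r in @setT rat) [set x | successor_rank x /\ q x = r]); last first.
  by apply/seteqP; split => [x sx|x [r _ []]//]; exists (q x).
apply: bigcup_countable => [|r _]; first exact: countableP.
apply: cccT => x y [sx qxr] [sy qyr] /eqP xy.
(* If [u < v], then [u] is at most the immediate predecessor [p] of [v], whence
   [q u < l u <= l p < q v]. *)
have no_lt u v : successor_rank u -> successor_rank v -> q u = q v -> ~ (u < v).
  move=> su sv quv uv.
  have [_ _ /andP[_ qu]] := qP _ su; have [p [pv pmax] /andP[pq _]] := qP _ sv.
  have : (l u <= l p)%R.
    have := pmax _ uv; rewrite le_eqVlt => /predU1P[->//|/lmono]; exact: ltW.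
  by move/(lt_le_trans qu)/(lt_trans); rewrite quv => /(_ _ pq); rewrite ltxx.
apply/negP => /orP[xley|ylex].
  by apply: (no_lt x y) => //; rewrite ?qxr ?qyr// lt_neqAle xy.
by apply: (no_lt y x) => //; rewrite ?qxr ?qyr// lt_neqAle eq_sym xy.
Qed.

(** * Total dyadic weight of a set of natural numbers *)

Section DyadicWeights.
Local Open Scope ring_scope.
Variable R : realType.
Implicit Types (P Q : set nat) (n i : nat).

Definition dyadic_weight i : R := 2^-1 ^+ i.+1.

Definition partial_weight P n : R :=
  \sum_(0 <= i < n | i \in P) dyadic_weight i.

(** This is the sum of the series of weights over [P]: the terms are positive and the partial sums
    are at most [1], so the supremum exists. *)
Definition set_weight P : R := sup (range (partial_weight P)).

Lemma dyadic_weight_gt0 i : 0 < dyadic_weight i.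
Proof. by rewrite exprn_gt0// invr_gt0. Qed.

Lemma partial_weight_mono P Q n m : (n <= m)%N ->
  (forall i, (i < n)%N -> P i -> Q i) ->
  partial_weight P n <= partial_weight Q m.
Proof.
move=> nm PQ; rewrite /partial_weight (big_cat_nat (n := n) _ _ (p := m))//=.
rewrite -[leLHS]addr0 lerD//; last first.
  by apply: sumr_ge0 => i _; exact/ltW/dyadic_weight_gt0.
rewrite big_mkcond [leRHS]big_mkcond; apply: ler_sum_nat => i /andP[_ iltn].
have [/set_mem iP|_] := boolP (i \in P); first by rewrite mem_set//; exact: PQ.
by case: ifP => // _; exact/ltW/dyadic_weight_gt0.
Qed.

Lemma partial_weight_le1 P n : partial_weight P n <= 1.
Proof.
apply: (le_trans (partial_weight_mono (Q := setT) (leqnn n) _)) => //.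
rewrite /partial_weight; under eq_bigl do rewrite in_setT.
suff -> : \sum_(0 <= i < n) dyadic_weight i = 1 - 2^-1 ^+ n.
  by rewrite gerBl exprn_ge0// invr_ge0.
elim: n => [|n IH]; first by rewrite big_nil expr0 subrr.
rewrite big_nat_recr//= IH /dyadic_weight exprS.
set t := 2^-1 ^+ n; rewrite -addrA; congr (_ + _).
by rewrite {1}(splitr t) [t / _]mulrC opprD addrNK.
Qed.

Lemma partial_weight_has_sup P : has_sup (range (partial_weight P)).
Proof.
split; first by exists (partial_weight P 0), 0%N.
by exists 1 => _ [n _ <-]; exact: partial_weight_le1.
Qed.

Lemma partial_weight_le P n : partial_weight P n <= set_weight P.
Proof.
by apply: (sup_upper_bound (partial_weight_has_sup P)); exists n.
Qed.

Lemma set_weight_ub P v :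
  (forall n, partial_weight P n <= v) -> set_weight P <= v.
Proof.
move=> Pv; apply: ge_sup; first by case: (partial_weight_has_sup P).
by move=> _ [n _ <-].
Qed.

Lemma set_weight_mono P Q : P `<=` Q -> set_weight P <= set_weight Q.
Proof.
move=> PQ; apply: set_weight_ub => n; apply: le_trans (partial_weight_le _ n).
by apply: partial_weight_mono => // i _; exact: PQ.
Qed.

Lemma partial_weightU1 P i n : ~ P i -> (i < n)%N ->
  partial_weight (P `|` [set i]) n = partial_weight P n + dyadic_weight i.
Proof.
move=> nPi iltn; rewrite /partial_weight big_mkcond [in RHS]big_mkcond.
rewrite !(bigD1_seq i) ?mem_index_iota ?iota_uniq ?iltn//=.
rewrite mem_set; last by right.
rewrite memNset// add0r addrC; congr (_ + _); apply: eq_bigr => j ji.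
by rewrite in_setU in_set1 (negbTE ji) orbF.
Qed.

Lemma set_weightU1 P i : ~ P i ->
  set_weight (P `|` [set i]) = set_weight P + dyadic_weight i.
Proof.
move=> nPi; apply/le_anti/andP; split.
  apply: set_weight_ub => n.
  (* A partial sum with at least [i.+1] terms includes the weight of [i]. *)
  apply: (@le_trans _ _ (partial_weight (P `|` [set i]) (maxn n i.+1))).
    by apply: partial_weight_mono => //; exact: leq_maxl.
  by rewrite partial_weightU1 ?leq_maxr// lerD2r partial_weight_le.
rewrite -lerBrDr; apply: set_weight_ub => n; rewrite lerBrDr.
apply: le_trans (partial_weight_le _ (maxn n i.+1)).
rewrite partial_weightU1 ?leq_maxr// lerD2r.
by apply: partial_weight_mono => //; exact: leq_maxl.
Qed.

(** A value below the supremum is already exceeded by some partial sum. This reduces continuity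
    along a branch to finitely many nodes. *)
Lemma set_weight_finite P v : v < set_weight P ->
  exists n, v < set_weight (P `&` [set i | (i < n)%N]).
Proof.
move=> /sup_gt[|_ [n _ <-] vn]; first by case: (partial_weight_has_sup P).
exists n; apply: lt_le_trans vn _; apply: le_trans (partial_weight_le _ n).
by apply: partial_weight_mono.
Qed.

End DyadicWeights.

(** * Order, antichains and meets in the road space *)

Section RoadOrder.
Context {R : realType} {d : Order.disp_t} {T : porderType d}.
Implicit Types (p q : road R T) (x y z : T).

Definition road_point (x : T) (t : R) (xt : road_set R T (x, t)) : road R T :=
  SigSub (mem_set xt).

Lemma road_set1 x : road_set R T (x, 1%R).
Proof. by split=> /=; [rewrite ltr01 lexx|left]. Qed.

Lemma road_leP p q : p <= q <->
  (val p).1 < (val q).1 \/ (val p).1 = (val q).1 /\ ((val p).2 <= (val q).2)%R.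
Proof.
rewrite -[p <= q]/(val p <= val q); case: (val p) (val q) => [x t] [y s] /=.
rewrite Order.ProdLexiOrder.leEprodlexi /=; split.
  move=> /andP[]; rewrite le_eqVlt => /predU1P[->|]; last by left.
  by rewrite lexx => ts; right.
move=> [xy|[-> ts]]; last by rewrite lexx ts.
by rewrite (ltW xy) (lt_geF xy).
Qed.

Lemma road_le_fst p q : p <= q -> (val p).1 <= (val q).1.
Proof. by move=> /road_leP[/ltW//|[-> _]]. Qed.

Lemma road_ltP p q : p < q <->
  (val p).1 < (val q).1 \/ (val p).1 = (val q).1 /\ ((val p).2 < (val q).2)%R.
Proof.
rewrite lt_leAnge; split.
  move=> /andP[/road_leP[|[pq1 pq2]] nqp]; [by left|right; split => //].
  rewrite ltNge; apply: contra nqp => qp2; apply/road_leP; right.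
  by split.
move=> H; apply/andP; split.
  by apply/road_leP; case: H => [|[? /ltW]]; [left|right].
apply/negP => /road_leP; case: H => [pq|[pq1 pq2]] [qp|[qp1 qp2]].
- by move: (lt_trans pq qp); rewrite ltxx.
- by move: pq; rewrite qp1 ltxx.
- by move: qp; rewrite pq1 ltxx.
- by move: pq2; rewrite ltNge qp2.
Qed.

Lemma road_comparable p q :
  (val p).1 <= (val q).1 \/ (val q).1 <= (val p).1 -> p <= q \/ q <= p.
Proof.
wlog pq : p q / (val p).1 <= (val q).1.
  move=> H [pq|qp]; first exact: H (or_introl pq).
  by apply/or_comm; exact: H (or_introl qp).
move=> _; move: pq; rewrite le_eqVlt => /predU1P[pq1|pq]; last first.
  by left; apply/road_leP; left.
by have [?|?] := leP (val p).2 (val q).2; [left|right]; apply/road_leP;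
  right; split => //; exact: ltW.
Qed.

(** Points over comparable nodes are comparable, so the first projection is injective on an
    antichain and its image is an antichain of [T]. *)
Lemma road_ccc : ccc T -> ccc (road R T).
Proof.
move=> cccT A anA.
have incomp p q : A p -> A q -> p <> q -> (val p).1 >< (val q).1.
  move=> Ap Aq pq; apply/negP => /orP/road_comparable/orP.
  exact/negP/anA.
apply: (@countable_inj_in _ _ (fun p => (val p).1) _
  [set (val p).1 | p in A]) => [p Ap|p q Ap Aq pq|].
- by exists p.
- apply: contrapT => npq; have := incomp p q Ap Aq npq.
  by rewrite /Order.comparable pq lexx.
apply: cccT => _ _ [p Ap <-] [q Aq <-] pq.
by apply: incomp => // pqE; apply: pq; rewrite pqE.
Qed.

Hypothesis wsT : well_stratified T.

Lemma road_tree_order : tree_order (road R T).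
Proof.
split; last first.
  move=> p q q' /road_le_fst qp /road_le_fst q'p; apply: road_comparable.
  exact: tree_linear qp q'p.
case: (wsT) => -[[r rmin] _] _; exists (road_point (road_set1 r)) => p.
apply/road_leP => /=; have := rmin (val p).1.
rewrite le_eqVlt => /predU1P[rp|]; last by left.
(* The root has no predecessor, so the only point over it has second coordinate [1]. *)
right; split => //; have [_ []] := set_valP p; first by move=> ->.
rewrite -rp => /(successor_rankP wsT)[z [zr _]].
by move: (lt_le_trans zr (rmin z)); rewrite ltxx.
Qed.

Lemma road_meet : hausdorff_tree T -> forall p q : road R T,
  exists m : road R T,
    [/\ m <= p, m <= q & forall z : road R T, z <= p -> z <= q -> z <= m].
Proof.
move=> hT p q; have [|/negP] := pselect ((val p).1 >=< (val q).1).
  move=> /orP/road_comparable[pq|qp]; [exists p|exists q]; split => //.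
move=> /(incomparable_common_pred wsT hT)[m [mp mq] mmax].
exists (road_point (road_set1 m)); split; [by apply/road_leP; left..|].
move=> z /road_le_fst zp /road_le_fst zq; apply/road_leP => /=.
have := mmax _ zp zq; rewrite le_eqVlt => /predU1P[zm|]; last by left.
by right; split => //; have [/andP[]] := set_valP z.
Qed.

End RoadOrder.

(** * A real coordinate for the points over a branch *)

Section BranchCoordinate.
Context {R : realType} {d : Order.disp_t} {T : porderType d}.
Hypothesis wsT : well_stratified T.
Variables (C : set T) (e : T -> nat).
Hypotheses (linC : linearly_ordered C)
  (downC : forall x y, C x -> y <= x -> C y)
  (einj : {in C &, injective e}).
Implicit Types (p q : road R T) (x y z : T) (D : set T).

(** Only nodes of successor rank are counted: a node of limit rank carries a single point of the
    road space, and a weight for it would leave a gap among the coordinates. *)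
Definition branch_weight D : R :=
  set_weight R (e @` (C `&` [set y | successor_rank y] `&` D)).

Definition branch_coordinate p : R :=
  (branch_weight [set y | y < (val p).1] +
    if `[< successor_rank (val p).1 >]
    then (val p).2 * dyadic_weight R (e (val p).1) else 0).

Lemma branch_weight_mono D D' :
  (forall y, C y -> D y -> D' y) -> (branch_weight D <= branch_weight D').
Proof.
move=> DD'; apply/set_weight_mono => _ [y [[Cy sy] Dy] <-].
by exists y => //; split; [split|exact: DD'].
Qed.

Lemma branch_weight_succ x : C x -> successor_rank x ->
  branch_weight [set y | y <= x] =
  (branch_weight [set y | y < x] + dyadic_weight R (e x)).
Proof.
move=> Cx sx; rewrite /branch_weight -set_weightU1.
  congr set_weight; apply/seteqP; split => i.
    move=> [y [[Cy sy] /=]]; rewrite le_eqVlt => /predU1P[->|yx] <-.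
      by right.
    by left; exists y.
  move=> [[y [[Cy sy] /= yx] <-]|->].
    by exists y => //; split => //=; exact: ltW.
  by exists x => //; split => /=.
move=> [y [[Cy sy] /= yx]] /einj; rewrite !inE => /(_ Cy Cx) yE.
by move: yx; rewrite yE ltxx.
Qed.

Lemma branch_weight_limit x : ~ successor_rank x ->
  branch_weight [set y | y <= x] = branch_weight [set y | y < x].
Proof.
move=> nsx; congr set_weight; congr (_ @` _); apply/seteqP; split => y.
  move=> [[Cy sy] /=]; rewrite le_eqVlt => /predU1P[yx|//].
  by rewrite yx in sy.
by move=> [Cy /= yx]; split => //=; exact: ltW.
Qed.

Lemma branch_coordinate1 p : C (val p).1 -> (val p).2 = 1%R ->
  branch_coordinate p = branch_weight [set y | y <= (val p).1].
Proof.
move=> Cp p1; rewrite /branch_coordinate p1 mul1r.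
case: asboolP => sp; first by rewrite branch_weight_succ.
by rewrite branch_weight_limit// addr0.
Qed.

(** Together with [branch_coordinate_ge], this confines the points over a node between the weight
    strictly below it and the weight up to it. These two agree at limit rank. *)
Lemma branch_coordinate_le p : C (val p).1 ->
  (branch_coordinate p <= branch_weight [set y | (y <= (val p).1)]).
Proof.
move=> Cp; rewrite /branch_coordinate.
case: asboolP => sp; last by rewrite branch_weight_limit// addr0.
rewrite branch_weight_succ// lerD2l ler_piMl//.
  exact/ltW/dyadic_weight_gt0.
by have [/andP[]] := set_valP p.
Qed.

Lemma branch_coordinate_ge p :
  (branch_weight [set y | (y < (val p).1)] <= branch_coordinate p).
Proof.
rewrite lerDl; case: asboolP => // _; have [/andP[t0 _] _] := set_valP p.
by rewrite mulr_ge0// ltW// dyadic_weight_gt0.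
Qed.

(** Two distinct points over one node force it to have successor rank, and the fractions decide.
    Over different nodes, the immediate successor [z] of the lower node towards the upper one adds a
    positive amount. *)
Lemma branch_coordinate_lt p q : C (val q).1 -> p < q ->
  (branch_coordinate p < branch_coordinate q).
Proof.
move=> Cq /road_ltP[pq|[pq1 pq2]]; last first.
  rewrite /branch_coordinate pq1 ltrD2l.
  case: asboolP => sq; first by rewrite ltr_pM2r// dyadic_weight_gt0.
  have [/andP[_ q1] _] := set_valP q.
  have [_ [p1|]] := set_valP p; last by rewrite pq1.
  by move: pq2; rewrite p1 ltNge q1.
have Cp := downC Cq (ltW pq).
apply: le_lt_trans (branch_coordinate_le Cp) _.
have [z [pz zmax] zq] := next_exists wsT pq.
have Cz := downC Cq zq.
have sz : successor_rank z by apply/(successor_rankP wsT); exists (val p).1.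
apply: (@le_lt_trans _ _ (branch_weight [set y | y < z])).
  by apply: branch_weight_mono => y _ /= yp; exact: le_lt_trans pz.
(* If [q] lies over [z] itself, only a fraction of the weight of [z] is counted, but that fraction
   is positive. *)
move: zq; rewrite le_eqVlt => /predU1P[zE|zq].
  rewrite /branch_coordinate -zE; case: asboolP => // _.
  have [/andP[q0 _] _] := set_valP q.
  by rewrite ltrDl mulr_gt0// dyadic_weight_gt0.
apply: lt_le_trans (branch_coordinate_ge q).
apply: (@lt_le_trans _ _ (branch_weight [set y | y <= z])).
  by rewrite branch_weight_succ// ltrDl dyadic_weight_gt0.
by apply: branch_weight_mono => y _ /= yz; exact: le_lt_trans zq.
Qed.

(* A finite partial sum below x only involves nodes up to some y < x. *)
Lemma branch_weight_continuous x x0 v : C x -> x0 < x ->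
  (v < branch_weight [set y | (y < x)]) ->
  exists2 y, y < x & (v < branch_weight [set z | (z <= y)]).
Proof.
move=> Cx x0x /set_weight_finite[n vn].
have [y yx ymax] : exists2 y, y < x &
    forall z, C z -> z < x -> (e z < n)%N -> z <= y.
  (* The bound starts at [x0] and is raised, when necessary, to the node below [x] numbered [n]. *)
  elim: n {vn} => [|n [y yx ymax]]; first by exists x0.
  have [[z [Cz zx zn]]|nz] := pselect (exists z, [/\ C z, z < x & e z = n]).
    have [yz|zy] := tree_linear wsT (ltW yx) (ltW zx);
      [exists z|exists y] => //;
      move=> u Cu ux; rewrite ltnS leq_eqVlt => /predU1P[un|un].
    - suff -> : u = z by [].
      by apply: einj; rewrite ?inE// zn.
    - by apply: le_trans yz; exact: ymax.
    - suff -> : u = z by [].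
      by apply: einj; rewrite ?inE// zn.
    - exact: ymax.
  exists y => // u Cu ux; rewrite ltnS leq_eqVlt => /predU1P[un|];
    last exact: ymax.
  by case: nz; exists u.
exists y => //; apply: lt_le_trans vn _; apply: set_weight_mono.
by move=> _ [[z [[Cz sz] zx] <-] zn]; exists z => //; split => //; exact: ymax.
Qed.

(** The image is convex. For [v] between two coordinates, take the least node [x] such that the
    weight up to [x] reaches [v]. At successor rank, [v] falls within the jump at [x] and is
    attained by some fraction of it; at limit rank, continuity forces [v] to be the coordinate of
    [(x, 1)]. *)
Lemma branch_coordinate_itv :
  exists i : interval R,
    branch_coordinate @` [set p | C (val p).1] = [set` i].
Proof.
set E := _ @` _; exists (normed_module.Rhull E).
suff : num_normedtype.is_interval E by move/normed_module.is_intervalP.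
move=> _ _ [a /= Ca <-] [b /= Cb <-] v /andP[].
rewrite le_eqVlt => /predU1P[<- _|av vb]; first by exists a.
have [||x [Cx vx] xmin] := chain_min wsT
    (C := [set x | C x /\ (v <= branch_weight [set y | (y <= x)])]).
- by move=> x y [Cx _] [Cy _]; exact: linC.
- exists (val b).1; split => //.
  exact: le_trans vb (branch_coordinate_le Cb).
have below y : C y -> y < x -> (branch_weight [set z | (z <= y)] < v).
  move=> Cy yx; rewrite ltNge; apply/negP => vy.
  by have := xmin _ (conj Cy vy); move/(lt_le_trans yx); rewrite ltxx.
have [/[dup] sx /(successor_rankP wsT)[p [px pmax]]|nsx] :=
  pselect (successor_rank x).
  have wx : (0 < dyadic_weight R (e x)) by exact: dyadic_weight_gt0.
  have hv : (branch_weight [set y | (y < x)] < v).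
    apply: le_lt_trans (below _ (downC Cx (ltW px)) px).
    by apply: branch_weight_mono => y _; exact: pmax.
  (* The fraction of the weight of [x] still missing to reach [v]. *)
  pose t := ((v - branch_weight [set y | (y < x)]) / dyadic_weight R (e x)).
  have xt : road_set R T (x, t).
    split; last by right.
    rewrite divr_gt0 ?subr_gt0//= ler_pdivrMr// mul1r lerBlDl.
    by rewrite -branch_weight_succ.
  exists (road_point xt) => //; rewrite /branch_coordinate /= asboolT//.
  by rewrite divfK ?gt_eqF// addrC subrK.
exists (road_point (road_set1 x)) => //; rewrite branch_coordinate1//=.
apply/le_anti; rewrite vx andbT branch_weight_limit// leNgt; apply/negP => vh.
(* Otherwise the coordinate of [a] would be at least the weight below [x], hence above [v]. So [x]
   has a node below it, from which the continuity argument can start. *)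
have ax : (val a).1 < x.
  have [|xa] := linC Ca Cx; first rewrite le_eqVlt => /predU1P[ax|//].
  - move: (lt_trans av vh); rewrite -ax ltNge.
    by rewrite branch_coordinate_ge.
  - move: (lt_trans av vh); rewrite ltNge; apply: contraNP => _.
    apply: le_trans (branch_coordinate_ge a).
    by apply: branch_weight_mono => y _ /= yx; exact: lt_le_trans xa.
have [y yx vy] := branch_weight_continuous Cx ax vh.
by move: (lt_trans (below _ (downC Cx (ltW yx)) yx) vy); rewrite ltxx.
Qed.

End BranchCoordinate.

(** * Branches of the road space, and the conclusion *)

Lemma road_branch_itv (R : realType) {d} (T : porderType d) :
  well_stratified T -> (forall C : set T, branch C -> countable C) ->
  forall B : set (road R T), branch B ->
  exists i : interval R, order_isomorphic B [set` i].
Proof.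
move=> wsT ctT B [linB maxB].
pose C := [set (val p).1 | p in B].
(* The points over a chain containing [C] form a chain containing [B], so by maximality they are
   exactly [B]. Hence [C] is itself maximal and [B] is its full preimage. *)
have lift_chain (D : set T) : linearly_ordered D -> C `<=` D ->
    [set p : road R T | D (val p).1] = B.
  move=> linD CD; apply: maxB => [p q Dp Dq|p Bp]; last by apply: CD; exists p.
  exact/road_comparable/linD.
have linC : linearly_ordered C.
  move=> _ _ [p Bp <-] [q Bq <-].
  by have [/road_le_fst|/road_le_fst] := linB _ _ Bp Bq; [left|right].
have maxC D : linearly_ordered D -> C `<=` D -> D = C.
  move=> linD CD; apply/seteqP; split => // x Dx.
  by exists (road_point (road_set1 x)) => //; rewrite -(lift_chain _ linD CD).
(* The downward closure of [C] is still a chain, so it equals [C]. *)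
have downC x y : C x -> y <= x -> C y.
  move=> Cx yx; rewrite -(maxC [set z | exists2 u, C u & z <= u]).
  - by exists x.
  - move=> z z' [u Cu zu] [u' Cu' zu']; have [uu'|u'u] := linC _ _ Cu Cu'.
      exact: tree_linear (le_trans zu uu') zu'.
    exact: tree_linear zu (le_trans zu' u'u).
  - by move=> z Cz; exists z.
have /countable_injP[e einj] : countable C by exact: ctT.
have [i iE] := branch_coordinate_itv (R := R) wsT linC downC einj.
exists i; rewrite -iE -(lift_chain C linC (@subset_refl _ _)).
(* On a chain, a strictly increasing map also reflects the order. *)
apply: order_isomorphic_image => p q; rewrite !inE => Cp Cq.
have [pq|qp] : p <= q \/ q <= p by exact/road_comparable/linC.
  rewrite pq; move: pq; rewrite le_eqVlt => /predU1P[->|pq].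
    by rewrite lexx.
  by apply/ltW/(branch_coordinate_lt wsT downC einj).
move: qp; rewrite le_eqVlt => /predU1P[->|qp]; first by rewrite !lexx.
rewrite (lt_geF qp) leNgt; apply/negbTE/negPn.
exact: (branch_coordinate_lt wsT downC einj).
Qed.

Theorem theorem6p6 (R : realType) (d : Order.disp_t) (T : porderType d) :
  suslin T -> hausdorff_tree T ->
  [/\ ccc (road R T),
      branchwise_real R (road R T) &
      ~ exists l : road R T -> R, continuous_grading l].
Proof.
move=> susT hT; have [cccT [wsT _ _ ctT]] := susT; split.
- exact: road_ccc.
- split; [exact: road_tree_order|exact: road_branch_itv|exact: road_meet].
- move=> [l [lmono _]]; apply: (suslin_not_real_embeddable (R := R) susT).
  exists (fun x => l (road_point (road_set1 x))) => x y xy.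
  by apply: lmono; apply/road_ltP; left.
Qed.
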